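(* Let $\mathbf u\in\mathcal A$, let $\mathcal I$ be a translation invariant free ideal of $\mathbb N$, and let $x\in[0,1)$ with $S=\operatorname{supp}(x)$ and $S_b=\operatorname{supp}_b(x)$. If (i) $S+1\subseteq^{\mathcal I}S$, (ii) $S_b\subseteq_{\mathcal I}S$, and (iii) $S-1\subseteq^{\mathcal I}S$, then $\bar x\in t_{\mathbf u}^{\mathcal I}(\mathbb T)$.
   Context: $\mathbb N=\{0,1,2,\dots\}$, $\mathbb N_+=\mathbb N\setminus\{0\}$, $\mathbb T=\mathbb R/\mathbb Z$ is the circle group, and $\bar x$ is the image of $x\in\mathbb R$ in $\mathbb T$. $\mathcal A$ is the family of arithmetic sequences: strictly increasing sequences of integers $\mathbf u=(u_n)_{n\in\mathbb N}$ with $u_0=1$ and $u_n\mid u_{n+1}$ for all $n$. Put $b_n=u_n/u_{n-1}$ for $n\in\mathbb N_+$. Every $x\in[0,1)$ has a unique representation $x=\sum_{n=1}^\infty c_n/u_n$ with $c_n\in\mathbb N$, $c_n<b_n$ for all $n\in\mathbb N_+$, and $c_n<b_n-1$ for infinitely many $n$; $\operatorname{supp}(x)=\{n\in\mathbb N_+:c_n\ne0\}$, $\operatorname{supp}_b(x)=\{n\in\mathbb N_+:c_n=b_n-1\}$. For $A\subseteq\mathbb N$ and $k\in\mathbb Z$, $A+k$ denotes $\{a+k:a\in A\}\cap\mathbb N$. An ideal $\mathcal I$ of $\mathbb N$ is a non-empty family of subsets of $\mathbb N$ closed under finite unions and subsets (not required to be proper); it is free if it contains all finite sets; it is translation invariant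 if $A\in\mathcal I$ implies $A+k\in\mathcal I$ for all $k\in\mathbb Z$. Write $A\subseteq^{\mathcal I}B$ if $A\setminus B\in\mathcal I$, and $A\subseteq_{\mathcal I}B$ if $A\subseteq B$ and $B\setminus A\in\mathcal I$. $t_{\mathbf u}^{\mathcal I}(\mathbb T)$ is the set of $z\in\mathbb T$ such that $\{n\in\mathbb N:u_nz\notin U\}\in\mathcal I$ for every neighborhood $U$ of $0$ in $\mathbb T$. *)

(* Defs.v *)
From HB Require Import structures.
From mathcomp Require Import all_boot all_order all_algebra.
From mathcomp Require Import generic_quotient ring_quotient.
From mathcomp Require Import all_classical all_reals all_analysis.
From mathcomp Require Import zify ring lra.
Import Order.TTheory GRing.Theory Num.Theory.
Import numFieldNormedType.Exports.

Set Implicit Arguments.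
Unset Strict Implicit.
Unset Printing Implicit Defensive.

Local Open Scope classical_set_scope.
Local Open Scope ring_scope.
Local Open Scope quotient_scope.

Definition integers (R : realType) : {pred R} := fun x => x \is a Num.int.

Lemma integers_zmod_closed (R : realType) : zmod_closed (@integers R).
Proof. by split; [exact: rpred0 | exact: rpredB]. Qed.

HB.instance Definition _ (R : realType) :=
  GRing.isZmodClosed.Build R (@integers R) (@integers_zmod_closed R).

Definition circle (R : realType) : Type := Quotient.quot (@integers R).

HB.instance Definition _ (R : realType) := GRing.Zmodule.on (circle R).
HB.instance Definition _ (R : realType) := EqQuotient.on (circle R).

(* quotient_topology carries its own choiceType structure, which clashes with
   the one underlying the group structure; hence only its open sets are
   transferred. *)
Definition circle_open (R : realType) : set_system (circle R) :=
  @open (quotient_topology (circle R)).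

HB.instance Definition _ (R : realType) :=
  @isOpenTopological.Build (circle R) (@circle_open R)
    (@openT (quotient_topology (circle R)))
    (@openI (quotient_topology (circle R)))
    (fun I f fo => @bigcup_open (quotient_topology (circle R)) I setT f
                     (fun i _ => fo i)).

Definition to_circle (R : realType) (x : R) : circle R := \pi_(circle R) x.

Definition arithmetic_seq (u : nat -> int) : Prop :=
  [/\ u 0%N = 1, {homo u : m n / (m < n)%N >-> m < n}
    & forall n, (u n %| u n.+1)%Z].

(* meaningful for 0 < n only *)
Definition ratio (u : nat -> int) (n : nat) : int := (u n %/ u n.-1)%Z.

(* The value c 0 is irrelevant. *)
Definition canonical_rep (R : realType) (u : nat -> int) (x : R)
    (c : nat -> nat) : Prop :=
  [/\ forall n, (0 < n)%N -> (c n)%:Z < ratio u n,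
      infinite_set [set n | (0 < n)%N /\ (c n)%:Z < ratio u n - 1]
    & series (fun n => (c n.+1)%:R / (u n.+1)%:~R) @ \oo --> x].

(* Specified by digitsP and digits_unique below for 0 <= x < 1. *)
Definition digits (R : realType) (u : nat -> int) (x : R) : nat -> nat :=
  xget (fun=> 0%N) [set c | canonical_rep u x c].

Definition supp (R : realType) (u : nat -> int) (x : R) : set nat :=
  [set n | (0 < n)%N /\ digits u x n <> 0%N].

Definition supp_b (R : realType) (u : nat -> int) (x : R) : set nat :=
  [set n | (0 < n)%N /\ (digits u x n)%:Z = ratio u n - 1].

Definition translate_set (A : set nat) (k : int) : set nat :=
  [set m | exists2 a, A a & m%:Z = a%:Z + k].

Definition set_ideal (I : set_system nat) : Prop :=
  [/\ I !=set0, setU_closed I & forall A B, A `<=` B -> I B -> I A].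

Definition free_ideal (I : set_system nat) : Prop :=
  set_ideal I /\ forall A, finite_set A -> I A.

Definition translation_invariant (I : set_system nat) : Prop :=
  forall A k, I A -> I (translate_set A k).

Definition subset_upto (I : set_system nat) (A B : set nat) : Prop :=
  I (A `\` B).

Definition subset_cosmall (I : set_system nat) (A B : set nat) : Prop :=
  A `<=` B /\ I (B `\` A).

Definition t_ideal (R : realType) (u : nat -> int) (I : set_system nat) :
    set (circle R) :=
  [set z | forall U, nbhs (0 : circle R) U -> I [set n | ~ U (z *~ u n)]].
Arguments t_ideal : clear implicits.

Section CanonicalRep.
Context (R : realType) (u : nat -> int) (uA : arithmetic_seq u).

Local Notation U n := ((u n)%:~R : R).
Local Notation S c := (series (fun n => (c n.+1)%:R / U n.+1)).

Let u_gt n : n%:Z < u n.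
Proof.
case: uA => u0 uM _; elim: n => [|n IH]; first by rewrite u0.
by have := uM n n.+1 (ltnSn n); lia.
Qed.

Let U_gt0 n : 0 < U n.
Proof. by rewrite ltr0z (le_lt_trans _ (u_gt n)). Qed.

Let U_neq0 n : U n != 0.
Proof. exact: lt0r_neq0. Qed.

Let US n : U n.+1 = (ratio u n.+1)%:~R * U n.
Proof. by case: uA => _ _ ud; rewrite -intrM /ratio /= divzK. Qed.

Let US_inv n : (U n)^-1 = (ratio u n.+1)%:~R / U n.+1.
Proof.
have r0 : (ratio u n.+1)%:~R != 0 :> R.
  by apply/eqP => r0; have := US n; rewrite r0 mul0r; exact/eqP.
by rewrite US invfM mulrA divff// mul1r.
Qed.

Let SS (c : nat -> nat) n : S c n.+1 = S c n + (c n.+1)%:R / U n.+1.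
Proof. by rewrite /series /= big_nat_recr. Qed.

Lemma canonical_rep_floor (x : R) c n : canonical_rep u x c ->
  (Num.floor (U n * x))%:~R = U n * S c n.
Proof.
move=> [cb ci cx]; pose F m := S c m + (U m)^-1.
have FS m : F m.+1 = F m + ((c m.+1)%:Z + 1 - ratio u m.+1)%:~R / U m.+1.
  by rewrite /F SS (US_inv m) !(intrD, intrN) -pmulrn; ring.
have Fle : {homo F : m p / (m <= p)%N >-> p <= m}.
  apply: homo_leq => [//|m p q|m]; first by move=> /[swap]; exact: le_trans.
  rewrite FS gerDl pmulr_lle0 ?invr_gt0// lerz0.
  by have := cb m.+1 isT; lia.
have Sle : {homo S c : m p / (m <= p)%N >-> m <= p}.
  by apply: nondecreasing_series => k _; rewrite divr_ge0 ?ler0n ?ltW.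
have xF m : x <= F m.
  apply: (cvgr_to_le cx); near=> p; apply: (@le_trans _ _ (F p)).
    by rewrite lerDl invr_ge0 ltW.
  by apply: Fle; near: p; exact: nbhs_infty_ge.
have [m [nm Fm]] : exists m, (n <= m)%N /\ F m.+1 < F m.
  have [[|m] [/andP[// _ mb] nm]] : exists m,
      ((0 < m)%N && ((c m)%:Z < ratio u m - 1)) /\ (n < m)%N.
    apply: contrapT => nex; apply: ci; apply: sub_finite_set (finite_II n.+1).
    move=> m [m0 mb] /=; rewrite ltnS leqNgt; apply/negP => nm.
    by apply: nex; exists m; rewrite m0 mb.
  exists m; split => //; rewrite FS gtrDl pmulr_llt0 ?invr_gt0// ltrz0.
  by move: mb; lia.
have Sx : S c n <= x.
  by apply: (cvgr_to_ge cx); near=> p; apply: Sle; near: p; exact: nbhs_infty_ge.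
have xS : x < S c n + (U n)^-1.
  by apply: le_lt_trans (xF m.+1) (lt_le_trans Fm (Fle _ _ nm)).
have [z Ez] : exists z : int, U n * S c n = z%:~R.
  elim: (n) => [|k [z Ez]]; first by exists 0; rewrite /series /= big_geq // mulr0.
  exists (ratio u k.+1 * z + (c k.+1)%:Z).
  rewrite SS mulrDr mulrC [U k.+1 * (_ / _)]mulrC divfK// {1}US.
  by rewrite [S c k * _]mulrC -mulrA Ez intrD intrM.
rewrite Ez; congr (_%:~R); apply: floor_def.
rewrite -{1}Ez ler_pM2l// Sx /= intrD -Ez.
by rewrite -[ltRHS](_ : U n * (S c n + (U n)^-1) = _) ?ltr_pM2l// mulrDr divff.
Unshelve. all: by end_near. Qed.

Lemma digits_unique (x : R) c c' n :
  canonical_rep u x c -> canonical_rep u x c' -> (0 < n)%N -> c n = c' n.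
Proof.
move=> cx cx'; case: n => // n _.
have E m : S c m = S c' m.
  by apply: (mulfI (U_neq0 m)); rewrite -!(@canonical_rep_floor x).
have := E n.+1; rewrite !SS E => /addrI /(mulIf (invr_neq0 (U_neq0 _))).
by move=> /eqP; rewrite eqr_nat => /eqP.
Qed.

Lemma canonical_rep_exists (x : R) :
  0 <= x < 1 -> exists c, canonical_rep u x c.
Proof.
move=> /andP[x0 x1]; pose f n := Num.floor (U n * x).
have fP n : (f n)%:~R <= U n * x < (f n)%:~R + 1.
  by rewrite -[1]/(1%:~R) -intrD floor_itv.
have u0 : U 0 = 1 by case: uA => ->.
have f0 : f 0%N = 0.
  by apply: floor_def; rewrite u0 mul1r x0 add0r.
pose d n := f n.+1 - ratio u n.+1 * f n.
have dP n : 0 <= d n < ratio u n.+1.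
  have /andP[a1 a2] := fP n; have /andP[b1 b2] := fP n.+1.
  have r0 : 0 < (ratio u n.+1)%:~R :> R.
    by have := U_gt0 n.+1; rewrite US pmulr_lgt0.
  rewrite US -mulrA in b1 b2.
  have A1 := ler_wpM2l (ltW r0) a1.
  have A2 : (ratio u n.+1)%:~R * (U n * x)
            < (ratio u n.+1)%:~R * ((f n)%:~R + 1) by rewrite ltr_pM2l.
  have B1 : (ratio u n.+1 * f n)%:~R < (f n.+1 + 1)%:~R :> R.
    by rewrite intrM intrD; exact: le_lt_trans A1 b2.
  have B2 : (f n.+1)%:~R < (ratio u n.+1 * (f n + 1))%:~R :> R.
    by rewrite intrM intrD; exact: le_lt_trans b1 A2.
  by move: B1 B2; rewrite !ltr_int /d mulrDr mulr1; lia.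
pose c n := `|d n.-1|%N.
have cE n : (c n.+1)%:Z = d n.
  by rewrite /c /= gez0_abs//; case/andP: (dP n).
have Sf n : S c n = (f n)%:~R / U n.
  elim: n => [|n IH]; first by rewrite f0 mul0r /series /= big_geq.
  rewrite SS IH US_inv pmulrn cE /d mulrA -mulrDl; congr (_ / _).
  by rewrite intrD intrN intrM; ring.
have xS n : S c n <= x < S c n + (U n)^-1.
  have /andP[a1 a2] := fP n.
  rewrite Sf ler_pdivrMr// [x * _]mulrC a1 /=.
  by rewrite -[_ + _^-1](mulfK (U_neq0 n)) ltr_pdivlMr// mulrDl mulVf// divfK// mulrC.
have cvU : (fun n => (U n)^-1) @ \oo --> (0 : R).
  apply: (@squeeze_cvgr _ _ _ _ (fun=> 0) (@harmonic R)); last 2 first.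
  - exact: cvg_cst.
  - exact: cvg_harmonic.
  near=> n; rewrite invr_ge0 ltW//= lef_pV2 ?posrE//.
  by rewrite pmulrn ler_int; have := u_gt n; lia.
have cvS : S c @ \oo --> x.
  have cv0 : (fun n => x - (U n)^-1) @ \oo --> x.
    by rewrite -[X in _ --> X]subr0; apply: cvgB => //; exact: cvg_cst.
  apply: (squeeze_cvgr _ cv0 (cvg_cst x)).
  by near=> n; have /andP[-> a] := xS n; rewrite andbT lerBlDr ltW.
exists c; split => //.
  by case=> // n _; rewrite cE; case/andP: (dP n).
move=> fin.
have [N cN] : exists N, forall n, (N <= n)%N -> (c n.+1)%:Z = ratio u n.+1 - 1.
  have [N NP] : exists N, forall n, (0 < n)%N /\ (c n)%:Z < ratio u n - 1 -> (n <= N)%N.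
    have /finite_seqP[s sE] := fin.
    exists (\max_(i <- s) i)%N => n nP; apply: (@leq_bigmax_seq _ s xpredT id) => //.
    by have : [set` s] n by rewrite -sE.
  exists N => n Nn; apply: contrapT => ne; have /andP[_] := dP n; rewrite -cE => lt.
  have : (n.+1 <= N)%N by apply: NP; split => //; lia.
  by lia.
have FN n : S c (N + n)%N + (U (N + n)%N)^-1 = S c N + (U N)^-1.
  elim: n => [|n <-]; first by rewrite addn0.
  rewrite addnS SS (US_inv (N + n)%N) pmulrn cN ?leq_addr// intrD intrN; ring.
have : (fun n => S c n + (U n)^-1) @ \oo --> x.
  by rewrite -[X in _ --> X]addr0; exact: cvgD.
rewrite -(cvg_shiftn N) => cvF.
have : (fun n => S c N + (U N)^-1) @ \oo --> x.
  by apply: cvg_trans cvF; apply: near_eq_cvg; near=> n; rewrite /= addnC FN.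
move=> /(cvg_unique (@norm_hausdorff _ _)) /(_ (cvg_cst _)) xE.
by have := xS N; rewrite -xE ltxx andbF.
Unshelve. all: by end_near. Qed.

Lemma digitsP (x : R) : 0 <= x < 1 -> canonical_rep u x (digits u x).
Proof.
by move=> /canonical_rep_exists[c cx]; apply: xgetPex; exists c.
Qed.

End CanonicalRep.

(* Main.v *)
(** Write [f n] for the floor of [u n * x], so that
    [f n.+1 = b n.+1 * f n + c n.+1]. A block of [m] consecutive zero digits
    after [n] gives [f (n + m) / u (n + m) = f n / u n], and a block of [m]
    maximal digits gives the same with [f + 1] in place of [f]; in both cases
    [u n * x] lies within [u n / u (n + m) <= 1 / (m + 1)] of an integer. By the
    hypotheses, the set [D] of those [k] at which membership in the support
    changes between [k] and [k + 1], or at which the digit is neither zero nor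
    maximal, is in the ideal, and a block of length [m] after [n] is of one of
    the two kinds unless [n] is in one of [D - 1, ..., D - m]. *)
Require Import Defs.
From mathcomp Require Import all_boot all_order all_algebra.
From mathcomp Require Import all_classical all_reals all_analysis.
From mathcomp Require Import zify ring lra.
Import Order.TTheory GRing.Theory Num.Theory.
Import numFieldNormedType.Exports.

Set Implicit Arguments.
Unset Strict Implicit.
Unset Printing Implicit Defensive.

Local Open Scope classical_set_scope.
Local Open Scope ring_scope.

Local Notation ratio := Defs.ratio.

Section Ideal.
Variable I : set_system nat.
Hypothesis idealI : set_ideal I.

Lemma ideal_sub (A B : set nat) : A `<=` B -> I B -> I A.
Proof. by case: idealI => _ _; apply. Qed.

Lemma idealU (A B : set nat) : I A -> I B -> I (A `|` B).
Proof. by case: idealI => _ + _; apply. Qed.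

Lemma ideal_set0 : I set0.
Proof. by case: idealI => -[A IA] _ sub; apply: sub IA. Qed.

Lemma ideal_bigcup (A : nat -> set nat) (m : nat) :
  (forall j, I (A j)) -> I (\bigcup_(j in `I_m) A j).
Proof.
move=> IA; elim: m => [|m IH]; first by rewrite II0 bigcup_set0; exact: ideal_set0.
rewrite IIS bigcup_setU bigcup_set1; exact: idealU.
Qed.

End Ideal.

Section Circle.
Variable R : realType.

Lemma to_circleMz (x : R) (n : int) : to_circle x *~ n = to_circle (x *~ n).
Proof. by rewrite /to_circle -raddfMz. Qed.

Lemma to_circleB_int (y : R) (z : int) : to_circle (y - z%:~R) = to_circle y.
Proof.
apply/eqP; rewrite /to_circle -Quotient.idealrBE.
by rewrite addrAC subrr add0r rpredN; exact: intr_int.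
Qed.

(** Open sets of the circle have open preimages in [R], so the preimage of an open set around 0
    contains a ball around 0. Moving [y] by the integer [z] into that ball does not change its
    class. *)
Lemma nbhs0_circle (U : set (circle R)) : nbhs (0 : circle R) U ->
  exists m : nat, forall (y : R) (z : int),
    `|y - z%:~R| <= m.+1%:R^-1 -> U (to_circle y).
Proof.
rewrite nbhsE => -[V [Vo V0] VU].
have : nbhs (0 : R) (@to_circle R @^-1` V).
  apply: open_nbhs_nbhs; split; first exact: Vo.
  by rewrite /preimage /= /to_circle raddf0.
move=> /nbhs_ballP[e /= e0 be].
have [m _ me0] := near_infty_natSinv_lt (PosNum e0).
have /= me := me0 m (leqnn m).
exists m => y z yz; apply: VU; rewrite -(to_circleB_int y z); apply: be.
by rewrite -ball_normE /= sub0r normrN (le_lt_trans yz).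
Qed.

End Circle.

Section Arithmetic.
Variables (R : realType) (u : nat -> int).
Hypothesis uA : arithmetic_seq u.

Lemma arithmetic_seq_gt0 n : 0 < u n.
Proof.
case: uA => u0 uM _; elim: n => [|n IH]; first by rewrite u0.
exact: lt_trans IH (uM _ _ (ltnSn n)).
Qed.

Lemma ratioP n : u n.+1 = ratio u n.+1 * u n.
Proof. by case: uA => _ _ ud; rewrite /ratio divzK. Qed.

Lemma ratio_gt1 n : 1 < ratio u n.+1.
Proof.
have [_ uM _] := uA; have := uM _ _ (ltnSn n).
by rewrite ratioP -[X in X < _]mul1r ltr_pM2r// arithmetic_seq_gt0.
Qed.

(** Every ratio is at least 2, and [2 * (m + 1) >= m + 2]. *)
Lemma arithmetic_seq_growth n m : m.+1%:Z * u n <= u (n + m)%N.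
Proof.
have u0 := arithmetic_seq_gt0 n.
elim: m => [|m IH]; first by rewrite addn0 mul1r.
by rewrite addnS ratioP; have := ratio_gt1 (n + m); nia.
Qed.

Section Floor.
Variable x : R.
Hypothesis x01 : 0 <= x < 1.
Local Notation c := (digits u x).
Local Notation f n := (Num.floor ((u n)%:~R * x)).

(** The floor is [u n] times the [n]-th partial sum of the expansion; the next term, multiplied by
    [u n.+1], is the digit itself. *)
Lemma floor_digits n : f n.+1 = ratio u n.+1 * f n + (c n.+1)%:Z.
Proof.
have rx := digitsP uA x01; apply/eqP; rewrite -(eqr_int R).
rewrite intrD intrM !(canonical_rep_floor uA _ rx).
rewrite /series /= big_nat_recr//= mulrDr [X in _ + X]mulrC divfK; last first.
  by rewrite intr_eq0 gt_eqF// arithmetic_seq_gt0.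
by rewrite {1}ratioP intrM mulrA.
Qed.

Lemma floor_zero_digits n m :
  (forall j, (j < m)%N -> c (n + j).+1 = 0%N) ->
  f (n + m)%N * u n = u (n + m)%N * f n.
Proof.
elim: m => [|m IH] cm; first by rewrite addn0 mulrC.
rewrite addnS floor_digits cm// addr0 ratioP -!mulrA IH// => j jm.
exact/cm/ltnW.
Qed.

(** A maximal digit turns the recursion for [f] into [f n.+1 + 1 = ratio u n.+1 * (f n + 1)]. *)
Lemma floor_max_digits n m :
  (forall j, (j < m)%N -> (c (n + j).+1)%:Z = ratio u (n + j).+1 - 1) ->
  (f (n + m)%N + 1) * u n = u (n + m)%N * (f n + 1).
Proof.
elim: m => [|m IH] cm; first by rewrite addn0 mulrC.
rewrite addnS floor_digits cm// ratioP -[RHS]mulrA -IH => [|j jm]; last exact/cm/ltnW.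
ring.
Qed.

Lemma dist_int_of_digits n m :
  (forall j, (j < m)%N -> c (n + j).+1 = 0%N) \/
  (forall j, (j < m)%N -> (c (n + j).+1)%:Z = ratio u (n + j).+1 - 1) ->
  exists z : int, `|(u n)%:~R * x - z%:~R| <= m.+1%:R^-1.
Proof.
set Un : R := (u n)%:~R; set Um : R := (u (n + m)%N)%:~R.
have Un0 : 0 < Un by rewrite ltr0z arithmetic_seq_gt0.
have Um0 : 0 < Um by rewrite ltr0z arithmetic_seq_gt0.
have le_m : Un / Um <= m.+1%:R^-1.
  rewrite ler_pdivrMr// ler_pdivlMl// /Un /Um pmulrn -intrM ler_int.
  exact: arithmetic_seq_growth.
have /andP[lo hi] : (f (n + m)%N)%:~R <= Um * x < (f (n + m)%N)%:~R + 1.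
  by rewrite -[1]/(1%:~R) -intrD floor_itv.
(* Here [d] is the error at level [n + m], which shrinks by [Un / Um] at level [n]. It is the
   fractional part of [Um * x] for zero digits, and that part minus 1 for maximal ones. *)
have key (z : int) (d : R) : Un * (Um * x) = Um * z%:~R + Un * d -> `|d| <= 1 ->
    `|Un * x - z%:~R| <= m.+1%:R^-1.
  move=> E d1; apply: le_trans le_m.
  have -> : Un * x - z%:~R = Un / Um * d.
    by apply: (mulfI (lt0r_neq0 Um0)); rewrite mulrBr mulrCA E; field; rewrite gt_eqF.
  by rewrite normrM gtr0_norm ?divr_gt0// ler_piMr// ltW// divr_gt0.
case=> [/floor_zero_digits|/floor_max_digits] /(congr1 (fun k : int => k%:~R : R)).
  rewrite !intrM => E; exists (f n); apply: (key _ (Um * x - (f (n + m)%N)%:~R)).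
    by rewrite -E; ring.
  by rewrite ler_norml; lra.
rewrite !intrM => E; exists (f n + 1).
apply: (key _ (Um * x - (f (n + m)%N + 1)%:~R)); first by rewrite -E; ring.
by rewrite intrD ler_norml; lra.
Qed.

End Floor.
End Arithmetic.

Definition support_defects (S T : set nat) : set nat :=
  [set k | S k /\ ~ S k.+1] `|` [set k | ~ S k /\ S k.+1] `|` (S `\` T).

(** Exits from [S] form a set contained in the translate by -1 of [(S + 1) \ S], hence the use of
    translation invariance; entries into [S] lie in [(S - 1) \ S] directly. *)
Lemma support_defects_ideal (I : set_system nat) (S T : set nat) :
  set_ideal I -> translation_invariant I ->
  subset_upto I (translate_set S 1) S -> subset_upto I (translate_set S (-1)) S ->
  I (S `\` T) -> I (support_defects S T).
Proof.
move=> idI tI S1 SN1 ST; apply: idealU => //; apply: idealU => //.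
  apply: (ideal_sub idI _ (tI _ (-1) S1)) => k [Sk nSk]; exists k.+1; last by lia.
  by split=> //; exists k => //; lia.
apply: (ideal_sub idI _ SN1) => k [nSk Sk]; split=> //.
by exists k.+1 => //; lia.
Qed.

Lemma block_of_no_defect (S T : set nat) (n m : nat) :
  (forall j, (j < m)%N -> ~ support_defects S T (n + j).+1) ->
  (forall j, (j < m)%N -> ~ S (n + j).+1) \/ (forall j, (j < m)%N -> T (n + j).+1).
Proof.
move=> nD.
(* Membership in [S] is constant along the block, since any change is a defect. *)
have SE j : (j < m)%N -> S (n + j).+1 <-> S n.+1.
  elim: j => [|j IH] jm; first by rewrite addn0.
  rewrite -IH ?(ltnW jm)// addnS.
  by split=> H; apply: contrapT => nH; apply: (nD j (ltnW jm)); left; [right|left].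
have [Sn|nSn] := pselect (S n.+1); [right|left] => j jm; last by rewrite SE.
by apply: contrapT => nT; apply: (nD j jm); right; split=> //; rewrite SE.
Qed.

Theorem theorem3p16 (R : realType) (u : nat -> int) (I : set_system nat)
    (x : R) :
  arithmetic_seq u -> free_ideal I -> translation_invariant I ->
  0 <= x < 1 ->
  subset_upto I (translate_set (supp u x) 1) (supp u x) ->
  subset_cosmall I (supp_b u x) (supp u x) ->
  subset_upto I (translate_set (supp u x) (-1)) (supp u x) ->
  t_ideal R u I (to_circle x).
Proof.
move=> uA [idI _] tI x01 S1 [_ Sb] SN1 U /nbhs0_circle[m mU].
pose D := support_defects (supp u x) (supp_b u x).
have ID : I D by exact: support_defects_ideal.
(* The [m] given by the neighborhood serves as block length; the block starts at [n + 1], hence the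
   shifts by [j + 1] with [j < m]. *)
apply: (ideal_sub idI _ (@ideal_bigcup _ idI (fun j => translate_set D (- j.+1%:Z)) m _)).
  move=> n nU; apply: contrapT => nD; apply: nU.
  have [z zP] : exists z : int, `|(u n)%:~R * x - z%:~R| <= m.+1%:R^-1.
    apply: dist_int_of_digits => //.
    have [|nS|Tn] := @block_of_no_defect (supp u x) (supp_b u x) n m.
    - by move=> j jm Dj; apply: nD; exists j => //; exists (n + j).+1 => //; lia.
    - by left=> j /nS nSj; apply: contrapT => cj; apply: nSj.
    - by right=> j /Tn[].
  by rewrite to_circleMz -mulrzl; exact: mU zP.
by move=> j; exact: tI.
Qed.
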